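(* Let $r$ be a positive integer and let $P$ be a convex polytope of dimension at least $r$ whose 1-skeleton (the graph of vertices and edges of $P$) contains no triangle. Then for any continuous function $f: P \to \mathbb{R}$ there exist $r$ pairwise disjoint faces of $P$ whose images under $f$ have a common point. In particular, this holds when $P$ is the $r$-dimensional hypercube. *)

(* Defs.v *)
From HB Require Import structures.
From mathcomp Require Export all_boot all_order all_algebra.
From mathcomp Require Export all_classical all_reals all_analysis.
Export Order.TTheory GRing.Theory Num.Theory numFieldNormedType.Exports.

#[export] Set Implicit Arguments.
#[export] Unset Strict Implicit.
#[export] Unset Printing Implicit Defensive.

Local Open Scope classical_set_scope.
Local Open Scope ring_scope.

Section Polytopes.
Variables (R : realType) (n : nat).
Implicit Types (A P F E : set 'rV[R]_n) (u v : 'rV[R]_n) (d : nat).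

Definition convex_hull A : set 'rV[R]_n := smallest (@convex_set R 'rV[R]_n) A.

Definition polytope P := exists2 A, finite_set A & P = convex_hull A.

Definition affine_subspace v (U : {vspace 'rV[R]_n}) : set 'rV[R]_n :=
  [set x | x - v \in U].

(* A has dimension d if its affine hull, i.e. the smallest affine subspace
   containing it, has dimension d; the empty set has no dimension. *)
Definition has_dim A d := exists v (U : {vspace 'rV[R]_n}),
  [/\ A v, A `<=` affine_subspace v U,
      (forall W : {vspace 'rV[R]_n},
         A `<=` affine_subspace v W -> (U <= W)%VS)
    & \dim U = d].

(* Faces are cut out by valid linear inequalities; phi = 0 with b = 0, resp.
   b = 1, yields the two improper faces P and set0. *)
Definition face P F := exists (phi : {scalar 'rV[R]_n}) (b : R),
  (forall x, P x -> phi x <= b) /\ F = P `&` [set x | phi x = b].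

Definition vertex P v := face P [set v].

Definition edge P E := face P E /\ has_dim E 1.

Definition adjacent P u v :=
  [/\ u != v, vertex P u, vertex P v & exists E, [/\ edge P E, E u & E v]].

Definition triangle_free P := ~ exists u v w : 'rV[R]_n,
  [/\ adjacent P u v, adjacent P v w & adjacent P u w].

Definition disjoint_faces_meet (r : nat) P :=
  forall f : 'rV[R]_n -> R, {within P, continuous f} ->
  exists F : 'I_r -> set 'rV[R]_n,
    [/\ forall i, face P (F i), trivIset setT F
      & exists y : R, forall i, (f @` F i) y].

Definition hypercube : set 'rV[R]_n := [set x | forall i, 0 <= x 0 i <= 1].

End Polytopes.

Arguments hypercube : clear implicits.

(* Main.v *)
From HB Require Import structures.
Require Import Defs.
From mathcomp Require Import all_boot all_order all_algebra.
From mathcomp Require Import all_classical all_reals all_analysis.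
From mathcomp Require Import lra ring.
Local Open Scope classical_set_scope.
Local Open Scope ring_scope.

(** The [r] faces are pairwise disjoint edges. By Balinski's theorem the graph of
    a polytope of dimension at least [r] is [r]-connected, so every vertex has
    degree at least [r]; the ends of an edge of a triangle-free graph have no
    common neighbour, so there are at least [2 r] vertices. Let [X] consist of
    [r] vertices with the smallest values of [f]. If some [S] in [X] had fewer
    than [#|S|] neighbours outside [X], then these neighbours together with
    [X \ S] would separate [S] from the rest and be fewer than [r]. Hence Hall's
    theorem matches [X] into its complement, and by the intermediate value
    theorem every matching edge takes the value [max f(X)]. *)

(** * Matchings in vertex-connected graphs *)

Section Matchings.
Import mathcomp.boot.fintype mathcomp.boot.finset.
Local Open Scope nat_scope.
Local Open Scope set_scope.

(** Induction on the size of [A]: either some nonempty proper [S] is tight and the problem splits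
    into [S] and [A :\: S], or every such set has slack and any neighbour of [a] may be matched to
    it first. *)
Lemma hall (T U : finType) (u0 : U) (N : T -> {set U}) (A : {set T}) :
  (forall S : {set T}, S \subset A -> #|S| <= #|\bigcup_(x in S) N x|) ->
  exists g : T -> U, {in A &, injective g} /\ {in A, forall x, g x \in N x}.
Proof.
have [m] := ubnP #|A|; elim: m => // m IH in A N *.
rewrite ltnS => leAm hallN.
have [->|[a aA]] := set_0Vmem A.
  by exists (fun=> u0); split=> x; rewrite inE.
have [/existsP[S /and3P[SA S0 NS]]|noS] :=
  boolP [exists S : {set T}, [&& S \proper A, S != set0
                               & #|\bigcup_(x in S) N x| <= #|S|]].
  have [sSA ltSA] := (proper_sub SA, proper_card SA).
  have [|S'|g1 [inj1 g1N]] := IH S N; first exact: leq_trans leAm.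
    by move=> /subset_trans/(_ sSA); exact: hallN.
  have ltDA : #|A :\: S| < #|A|.
    by rewrite cardsDS// ltn_subrL card_gt0 S0; apply/card_gt0P; exists a.
  have [|S'|g2 [inj2 g2N]] :=
    IH (A :\: S) (fun x => N x :\: \bigcup_(y in S) N y);
    first exact: leq_trans leAm.
    (* Hall's condition for [S :|: S'], minus the at most [#|S|] neighbours of [S], yields it for
       [S'] once those neighbours are removed. *)
    rewrite subsetD => /andP[sS'A dis].
    have := hallN (S :|: S'); rewrite subUset sSA sS'A => /(_ isT).
    rewrite cardsU disjoint_setI0 1?disjoint_sym// cards0 subn0.
    have : \bigcup_(x in S :|: S') N x \subset (\bigcup_(x in S) N x) :|:
        \bigcup_(x in S') (N x :\: \bigcup_(y in S) N y).
      apply/bigcupsP => x xSS'; apply/subsetP => y yx; rewrite inE.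
      case: (boolP (y \in \bigcup_(x in S) N x)) => //= yS.
      move: xSS'; rewrite inE => /orP[xS|xS'].
        by case/negP: yS; apply/bigcupP; exists x.
      by apply/bigcupP; exists x => //; rewrite inE yS.
    move=> /subset_leq_card; rewrite cardsU => le1 le2.
    have := leq_trans le2 (leq_trans le1 (leq_subr _ _)).
    by move=> le3; rewrite -(leq_add2l #|S|) (leq_trans le3)// leq_add2r.
  exists (fun x => if x \in S then g1 x else g2 x).
  have sep x y : x \in S -> y \in A -> y \notin S -> g1 x != g2 y.
    move=> xS yA yS; apply/eqP => g12.
    have := g2N y; rewrite !inE yA yS => /(_ isT)/andP[/bigcupP[]].
    by exists x => //; rewrite -g12 g1N.
  split=> x.
    move=> y xA yA; case: ifPn => xS; case: ifPn => yS.
    - exact: inj1.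
    - by move/eqP; rewrite (negbTE (sep _ _ _ _ _)).
    - by move/esym/eqP; rewrite (negbTE (sep _ _ _ _ _)).
    - by apply: inj2; rewrite inE ?xS ?yS.
  move=> xA; case: ifPn => xS; first exact: g1N.
  by have := g2N x; rewrite !inE xS xA => /(_ isT)/andP[].
have tight (S : {set T}) : S \proper A -> S != set0 -> #|S| < #|\bigcup_(x in S) N x|.
  move=> SA S0; rewrite ltnNge; apply: contra noS => NS.
  by apply/existsP; exists S; apply/and3P.
have [y yNa] : exists y, y \in N a.
  apply/set0Pn; have := hallN [set a].
  by rewrite sub1set aA big_set1 cards1 card_gt0 => /(_ isT).
have [||g [injg gN]] := IH (A :\ a) (fun x => N x :\ y).
- by rewrite (leq_trans _ leAm)// [ltnRHS](cardsD1 a) aA.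
- move=> S; rewrite subsetD1 => /andP[SA aS].
  have [->|S0] := eqVneq S set0; first by rewrite cards0.
  have/tight/(_ S0) : S \proper A by apply/properP; split=> //; exists a.
  have -> : \bigcup_(x in S) (N x :\ y) = (\bigcup_(x in S) N x) :\ y.
    apply/setP=> z; apply/bigcupP/setD1P.
      by case=> x xS /setD1P[zy zx]; split=> //; apply/bigcupP; exists x.
    by case=> zy /bigcupP[x xS zx]; exists x => //; rewrite !inE zy.
  by rewrite (cardsD1 y (\bigcup_(x in S) N x)); case: (y \in _) => // /ltnW.
have gA x : x \in A -> x != a -> (g x != y) && (g x \in N x).
  by move=> xA xa; have := gN x; rewrite !inE xa xA => /(_ isT).
exists (fun x => if x == a then y else g x); split=> x.
  move=> z xA zA; case: (eqVneq x a) => [->|xa]; case: (eqVneq z a) => [->|za] //.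
  - by move/esym/eqP; case/andP: (gA z zA za) => /negbTE->.
  - by move/eqP; case/andP: (gA x xA xa) => /negbTE->.
  - by apply: injg; rewrite !inE ?xa ?za.
by move=> xA; case: eqVneq => [->//|xa]; case/andP: (gA x xA xa).
Qed.

(* [k]-vertex-connectivity in the form: deleting fewer than [k] vertices [C]
   leaves no nontrivial vertex set [S] that is closed under adjacency. *)
Definition vertex_connected (T : finType) (e : rel T) (k : nat) :=
  forall S C : {set T}, #|C| < k -> S :&: C = set0 -> S != set0 ->
    ~: (S :|: C) != set0 ->
  exists x y, [/\ x \in S, y \notin S :|: C & e x y].

Variables (T : finType) (e : rel T) (k : nat).
Hypothesis e_irr : irreflexive e.
Hypothesis e_conn : vertex_connected e k.

Lemma crossing_matching (A : {set T}) : #|A| = k -> k <= #|~: A| ->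
  exists g : T -> T, {in A &, injective g} /\
    {in A, forall x, g x \notin A /\ e x (g x)}.
Proof.
move=> cA cB; have [->|[a aA]] := set_0Vmem A.
  by exists id; split=> x; rewrite inE.
have [S SA|g [injg gN]] := @hall T T a (fun x => [set y | (y \notin A) && e x y]) A.
  rewrite leqNgt; apply/negP => ltNS; set N := \bigcup_(x in S) _ in ltNS.
  have NA y : y \in N -> y \notin A.
    by case/bigcupP => x _; rewrite inE => /andP[].
  have S0 : S != set0 by rewrite -card_gt0 (leq_ltn_trans _ ltNS).
  have disAN : (A :\: S) :&: N = set0.
    apply/setP => x; rewrite !inE; apply/negbTE/negP => /andP[/andP[_ xA]].
    by move/NA; rewrite xA.
  have ltC : #|A :\: S :|: N| < k.
    rewrite cardsU disAN cards0 subn0 cardsDS// -cA.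
    by rewrite -[ltnRHS](@subnK #|S|) ?subset_leq_card// ltn_add2l.
  (* Since [#|N| < #|S| <= k <= #|~: A|], the cut leaves a vertex on its far side. *)
  have [y yA yN] : exists2 y, y \notin A & y \notin N.
    have /subsetPn[y] : ~~ (~: A \subset N).
      apply/negP => /subset_leq_card; apply/negP; rewrite -ltnNge.
      by rewrite (leq_trans ltNS)// (leq_trans (subset_leq_card SA))// cA.
    by rewrite inE => yA yN; exists y.
  have [] := e_conn ltC _ S0.
  - apply/setP => x; rewrite !inE; case: (boolP (x \in S)) => //= xS.
    by apply/negbTE/negP => /NA/negP; apply; move/subsetP: SA; exact.
  - apply/set0Pn; exists y; rewrite !inE (negbTE yA) (negbTE yN) andbF !orbF.
    by apply: contra yA; move/subsetP: SA; exact.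
  - move=> x [z [xS]]; rewrite !inE !negb_or => /and3P[zS zAS zN] exz.
    have zA : z \notin A by move: zAS; rewrite zS.
    by case/negP: zN; apply/bigcupP; exists x => //; rewrite inE zA.
by exists g; split=> // x /gN; rewrite inE => /andP[].
Qed.

(** Fewer than [k] neighbours would cut [x] off from the remaining vertices, and [k < #|T|] ensures
    that some remain. *)
Lemma min_degree (x : T) : k < #|T| -> k <= #|[set y | e x y]|.
Proof.
move=> ltkT; rewrite leqNgt; apply/negP => ltNk.
have [] := e_conn (S := [set x]) ltNk.
- apply/setP => y; rewrite !inE; case: eqVneq => //= ->; exact: e_irr.
- by rewrite -card_gt0 cards1.
- rewrite -card_gt0 cardsCs setCK subn_gt0.
  by rewrite cardsU1 inE e_irr/= (leq_ltn_trans _ ltkT).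
- move=> _ [y [/set1P->]]; rewrite !inE negb_or => /andP[_ /negP]; exact.
Qed.

Lemma triangle_free_card : 0 < k < #|T| ->
  (forall x y z, e x y -> e y z -> e x z -> False) -> k + k <= #|T|.
Proof.
move=> /andP[k0 kT] trif.
have [x _] : exists x : T, x \in T by apply/card_gt0P; exact: ltn_trans kT.
have [y] : exists y, y \in [set y | e x y].
  by apply/card_gt0P; rewrite (leq_trans k0)// min_degree.
rewrite inE => exy.
have := max_card [set z | e x z || e y z]; apply: leq_trans.
have -> : [set z | e x z || e y z] = [set z | e x z] :|: [set z | e y z].
  by apply/setP => z; rewrite !inE.
rewrite cardsU [X in _ - #|pred_of_set X|](_ : _ = set0) ?cards0 ?subn0.
  by rewrite leq_add ?min_degree.
apply/setP => z; rewrite !inE; apply/negbTE/negP => /andP[exz eyz].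
exact: trif exy eyz exz.
Qed.

Lemma initial_set (R : realType) (h : T -> R) (m : nat) : m <= #|T| ->
  exists A : {set T}, #|A| = m /\
    {in A & ~: A, forall x y, (h x <= h y)%R}.
Proof.
elim: m => [_|m IH ltmT].
  by exists set0; split=> [|x y]; rewrite ?cards0 ?inE.
have [A [cA hA]] := IH (ltnW ltmT).
have [x0 x0A] : exists x, x \in ~: A.
  by apply/card_gt0P; rewrite cardsCs setCK cA subn_gt0.
case: (arg_minP h x0A) => x xA xmin.
have xNA : x \notin A by rewrite -in_setC; exact: xA.
exists (x |: A); split; first by rewrite cardsU1 xNA cA.
move=> y z; rewrite !inE negb_or => yxA /andP[_ zA].
have zCA : z \in ~: A by rewrite inE.
by case/orP: yxA => [/eqP->|yA]; [exact: xmin | exact: hA].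
Qed.

(* Match the [k] vertices of smallest height with the others: every edge of the
   matching then spans the largest of these [k] heights. *)
Lemma level_matching (R : realType) (h : T -> R) : 0 < k < #|T| ->
    (forall x y z, e x y -> e y z -> e x z -> False) ->
  exists (a b : 'I_k -> T) (t : R),
    [/\ forall i, e (a i) (b i), forall i, (h (a i) <= t <= h (b i))%R
      & forall i j, i != j ->
          [/\ a i != a j, a i != b j, b i != a j & b i != b j]].
Proof.
move=> kT trif; have cT := triangle_free_card kT trif.
case/andP: kT => k0 kT.
have [A [cA hA]] := initial_set h (ltnW kT).
have [|g [injg gA]] := crossing_matching cA.
  by rewrite cardsCs setCK cA -(leq_add2r k) subnK// ltnW.
have [x0 x0A] : exists x, x \in A by apply/card_gt0P; rewrite cA.
case: (arg_maxP h x0A) => m mA mmax.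
pose a (i : 'I_k) := enum_val (cast_ord (esym cA) i).
have aA i : a i \in A by exact: enum_valP.
have inja : injective a by move=> i j /enum_val_inj/cast_ord_inj.
exists a, (g \o a), (h m); split=> [i|i|i j ij] /=.
- by have [] := gA _ (aA i).
- apply/andP; split; first exact/mmax/aA.
  by apply: hA => //; rewrite inE; have [] := gA _ (aA i).
- split; first by rewrite (inj_eq inja).
  + by apply: contraNneq (gA _ (aA j)).1 => <-.
  + by apply: contraNneq (gA _ (aA i)).1 => ->.
  + by apply: contra_neq ij => /injg gij; apply: inja; apply: gij.
Qed.

End Matchings.

(** * Functionals and convex sets *)

Lemma seq_argmax (R : realType) (T : eqType) (s : seq T) (h : T -> R) x0 :
  x0 \in s -> exists2 m, m \in s & {in s, forall x, h x <= h m}.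
Proof.
elim: s x0 => // y s IH x0 _.
have [->|[z zs]] : s = [::] \/ exists z, z \in s.
  by case: (s) => [|z ?]; [left | right; exists z; rewrite mem_head].
  by exists y => [|x]; rewrite inE// => /eqP->.
have [m ms mmax] := IH z zs.
case: (lerP (h y) (h m)) => hym.
  exists m => [|x]; first by rewrite inE ms orbT.
  by rewrite inE => /orP[/eqP->//|/mmax].
exists y => [|x]; first exact: mem_head.
by rewrite inE => /orP[/eqP->//|/mmax/le_trans->//]; exact: ltW.
Qed.

Lemma large_multiple (R : realType) (s : seq (R * R)) :
  exists k : R, 0 <= k /\ {in s, forall p, 0 < p.1 -> p.2 < k * p.1}.
Proof.
elim: s => [|p s [k [k0 IH]]]; first by exists 0.
exists (k + `|p.2 / p.1| + 1); split; first by rewrite !addr_ge0.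
move=> q; rewrite inE => /orP[/eqP-> p0|qs q0].
  have : p.2 <= `|p.2 / p.1| * p.1.
    rewrite -[X in _ * X](gtr0_norm p0) -normrM divfK ?gt_eqF//; exact: ler_norm.
  have : 0 <= k * p.1 by rewrite mulr_ge0// ltW.
  lra.
have := IH q qs q0; have : 0 <= `|p.2 / p.1| * q.1 by rewrite mulr_ge0// ltW.
lra.
Qed.

Section Functionals.
Variables (R : realType) (n : nat).
Implicit Types (c l u v w x y : 'rV[R]_n) (s : seq 'rV[R]_n).

(** Functionals are represented by vectors, so that a point can itself serve as a functional, as in
    [exposed_max]. *)
Definition dot c x : R := (x *m c^T) 0 0.

Lemma dotDr c x y : dot c (x + y) = dot c x + dot c y.
Proof. by rewrite /dot mulmxDl mxE. Qed.

Lemma dotNr c x : dot c (- x) = - dot c x.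
Proof. by rewrite /dot mulNmx mxE. Qed.

Lemma dotZr c k x : dot c (k *: x) = k * dot c x.
Proof. by rewrite /dot -scalemxAl mxE. Qed.

Lemma dotC c x : dot c x = dot x c.
Proof. by rewrite /dot -[in RHS](trmxK c) -trmx_mul [in RHS]mxE. Qed.

Lemma dotDl c l x : dot (c + l) x = dot c x + dot l x.
Proof. by rewrite dotC dotDr !(dotC x). Qed.

Lemma dotNl c x : dot (- c) x = - dot c x.
Proof. by rewrite dotC dotNr dotC. Qed.

Lemma dotZl c k x : dot (k *: c) x = k * dot c x.
Proof. by rewrite dotC dotZr dotC. Qed.

Definition dotE := (dotDr, dotNr, dotZr, dotDl, dotNl, dotZl).

Lemma dot_gt0 x : x != 0 -> 0 < dot x x.
Proof.
move=> x0; have [i xi] : exists i, x 0 i != 0.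
  by apply/rV0Pn.
rewrite /dot mxE (bigD1 i)//= mxE ltr_pwDl//.
  by rewrite lt_neqAle sqr_ge0 eq_sym mulf_neq0.
by apply: sumr_ge0 => j _; rewrite mxE sqr_ge0.
Qed.

Lemma dot_scalar c : scalar (dot c).
Proof. by move=> k x y; rewrite dotDr dotZr. Qed.

HB.instance Definition _ c :=
  GRing.isLinear.Build R 'rV[R]_n R *%R (dot c) (dot_scalar c).

Lemma scalar_dot (phi : {scalar 'rV[R]_n}) : exists c, phi =1 dot c.
Proof.
exists (\row_i phi (delta_mx 0 i)) => x.
rewrite /dot mxE {1}[x]row_sum_delta linear_sum; apply: eq_bigr => i _.
by rewrite linearZ !mxE.
Qed.

(** For large [k], [k *: c + l] compares finitely many points by [c] first and by [l] only on
    ties. *)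
Lemma lex_functional s c l : exists k : R, 0 <= k /\
  {in s &, forall x y, dot c x < dot c y ->
     dot (k *: c + l) x < dot (k *: c + l) y}.
Proof.
have [k [k0 hk]] :=
  large_multiple [seq (dot c y - dot c x, dot l x - dot l y) | x <- s, y <- s].
exists k; split=> // x y xs ys cxy.
have := hk _ (allpairs_f (fun x y => (dot c y - dot c x, dot l x - dot l y)) xs ys).
rewrite /= subr_gt0 !dotE => /(_ cxy); lra.
Qed.

(* Among the maximizers of [c], one of largest Euclidean norm is strictly
   exposed: by itself, and hence by [k *: c] plus itself for large [k]. *)
Lemma exposed_max s c x0 : x0 \in s ->
  exists t l, [/\ t \in s, {in s, forall x, x != t -> dot l x < dot l t},
    {in s, forall x, dot c x <= dot c t}
    & {in s &, forall x y, dot c x < dot c y -> dot l x < dot l y}].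
Proof.
move=> /(seq_argmax (dot c))[m ms mmax].
have [|t] := @seq_argmax R _ [seq x <- s | dot c x == dot c m] (fun x => dot x x) m.
  by rewrite mem_filter eqxx.
rewrite mem_filter => /andP[/eqP ctm ts] tmax.
have [k [k0 hk]] := lex_functional s c t.
exists t, (k *: c + t); split=> // x xs; last by rewrite ctm mmax.
move=> xt; have [cx|cx] := ltrP (dot c x) (dot c t); first exact: hk.
have cxt : dot c x = dot c t.
  by apply/eqP; rewrite eq_le cx ctm mmax.
have := tmax x; rewrite mem_filter cxt ctm eqxx xs => /(_ isT).
(* Expanding this square and using that [x] is no longer than [t] gives [dot t x < dot t t]. *)
have : 0 < dot (x - t) (x - t) by apply: dot_gt0; rewrite subr_eq0.
rewrite !dotE (dotC x t) cxt; lra.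
Qed.

(** With the points of [s] as rows of [M], the columns of [cokermx M] are functionals vanishing on
    [s], and together they detect every vector outside the row space. *)
Lemma span_separation s y : y \notin span s ->
  exists c, {in s, forall x, dot c x = 0} /\ dot c y != 0.
Proof.
move=> ys; pose M := \matrix_(i < size s) s`_i.
have nyM : ~~ (y <= M)%MS.
  apply: contra ys => /submxP[D ->]; rewrite mulmx_sum_row.
  by apply: rpred_sum => i _; rewrite rowK rpredZ// memv_span// mem_nth.
move: nyM; rewrite submxE => /rV0Pn[j yj].
have dotcol x : dot (col j (cokermx M))^T x = (x *m cokermx M) 0 j.
  by rewrite /dot trmxK !mxE; apply: eq_bigr => i _; rewrite mxE.
exists (col j (cokermx M))^T; split; last by rewrite dotcol.
move=> x xs; rewrite dotcol.
have -> : x = row (Ordinal (etrans (index_mem x s) xs)) M by rewrite rowK nth_index.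
by rewrite -row_mul mulmx_coker !mxE.
Qed.

Definition line_segment u w : set 'rV[R]_n :=
  [set x | exists2 s : R, 0 <= s <= 1 & x = (1 - s) *: u + s *: w].

Lemma line_segmentC u w : line_segment u w = line_segment w u.
Proof.
suff sub a b : line_segment a b `<=` line_segment b a.
  by apply/seteqP; split.
move=> x [s s01 ->]; exists (1 - s); first lra.
by rewrite subKr addrC.
Qed.

Lemma line_segmentl u w : line_segment u w u.
Proof. by exists 0; rewrite ?lexx ?ler01// subr0 scale1r scale0r addr0. Qed.

Lemma line_segmentr u w : line_segment u w w.
Proof. by rewrite line_segmentC; exact: line_segmentl. Qed.

Lemma convex_setP (S : set 'rV[R]_n) :
  @convex_set R 'rV[R]_n S <-> forall u w, S u -> S w -> line_segment u w `<=` S.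
Proof.
split=> [cS u w Su Sw _ [s /andP[s0 s1] ->]|cS u w s].
  have := cS w u (Itv01 s0 s1); rewrite !inE => /(_ Sw Su).
  by rewrite addrC.
rewrite !inE => Su Sw; apply: (cS w u) => //.
by exists s%:num; [apply/andP; split | rewrite addrC].
Qed.

Lemma convex_line_segment u w : @convex_set R 'rV[R]_n (line_segment u w).
Proof.
apply/convex_setP => _ _ [s s01 ->] [t t01 ->] _ [k k01 ->].
exists ((1 - k) * s + k * t); first nra.
by apply/rowP => i; rewrite !mxE; ring.
Qed.

Lemma convex_point v : @convex_set R 'rV[R]_n [set v].
Proof.
apply/convex_setP => _ _ -> -> _ [s _ ->] /=.
by rewrite -scalerDl subrK scale1r.
Qed.

Lemma convex_affine_subspace v (U : {vspace 'rV[R]_n}) :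
  @convex_set R 'rV[R]_n (affine_subspace v U).
Proof.
apply/convex_setP => u w uU wU _ [s _ ->]; rewrite /affine_subspace/=.
have -> : (1 - s) *: u + s *: w - v = (1 - s) *: (u - v) + s *: (w - v).
  by apply/rowP => i; rewrite !mxE; ring.
by rewrite rpredD// rpredZ.
Qed.

(** A proper convex combination reaches level [b] only if both ends do. This set records both the
    inequality and where it is tight, so one hull argument settles both. *)
Lemma convex_halfspace c (b : R) (S : set 'rV[R]_n) : @convex_set R 'rV[R]_n S ->
  @convex_set R 'rV[R]_n [set x | dot c x <= b /\ (dot c x = b -> S x)].
Proof.
move=> /convex_setP cS; apply/convex_setP => u w [ub uS] [wb wS] _ [s s01 ->].
rewrite /= !dotE; split; first nra.
have [->|s0] := eqVneq s 0.
  by rewrite subr0 scale1r scale0r addr0 => e; apply: uS; lra.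
have [->|s1 e] := eqVneq s 1.
  by rewrite subrr scale1r scale0r add0r => e; apply: wS; lra.
have {}s01 : 0 < s < 1 by rewrite !lt_neqAle eq_sym s0 s1; case/andP: s01 => -> ->.
by apply: (cS u w); [apply: uS; nra | apply: wS; nra | exists s => //; lra].
Qed.

End Functionals.

(** * Faces of polytopes *)

Section FacesOfSets.
Variables (R : realType) (n : nat) (P : set 'rV[R]_n).
Implicit Types (c u v w x : 'rV[R]_n).

Lemma faceP F : face P F <-> exists c (b : R),
  (forall x, P x -> dot c x <= b) /\ F = P `&` [set x | dot c x = b].
Proof.
split=> [[phi [b [Pb ->]]]|[c [b cb]]]; last by exists (dot c), b.
have [c phic] := scalar_dot phi; exists c, b; split=> [x Px|].
  by rewrite -phic Pb.
by apply/seteqP; split=> x /= [Px]; rewrite phic.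
Qed.

Lemma vertex_in v : vertex P v -> P v.
Proof. by move=> /faceP[c [b [_ e]]]; have : [set v] v by []; rewrite {1}e => -[]. Qed.

Lemma vertex_face v : vertex P v ->
  exists c, forall x, P x -> x != v -> dot c x < dot c v.
Proof.
move=> /faceP[c [b [Pb e]]]; exists c => x Px.
have : [set v] v by []; rewrite {1}e => -[_ /= ->].
apply: contra_neqT; rewrite -leNgt => cx.
suff : [set v] x by []; rewrite e; split=> //=.
by apply/eqP; rewrite eq_le cx Pb.
Qed.

Lemma vertex_in_segment v u w : vertex P v -> P u -> P w ->
  line_segment u w v -> v = u \/ v = w.
Proof.
move=> /vertex_face[c cv] Pu Pw [s s01 vE].
have [->|uv] := eqVneq u v; first by left.
have [->|wv] := eqVneq w v; first by right.
have := cv u Pu uv; have := cv w Pw wv.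
have : dot c v = (1 - s) * dot c u + s * dot c w by rewrite [in LHS]vE !dotE.
by case: (lerP (dot c u) (dot c w)) => *; exfalso; nra.
Qed.

(** A valid inequality tight at a convex combination is tight at every end of positive weight. *)
Lemma face_segment F u w x : face P F -> P u -> P w ->
  line_segment u w x -> F x -> F u \/ F w.
Proof.
move=> /faceP[c [b [Pb ->]]] Pu Pw [s s01 ->] [_ /=]; rewrite !dotE => e.
have := Pb u Pu; have := Pb w Pw => cw cu.
have [cub|cub] := eqVneq (dot c u) b; first by left.
right; split=> //=; have [s0|s0] := eqVneq s 0.
  by case/eqP: cub; rewrite -e s0; lra.
have {}cub : dot c u < b by rewrite lt_neqAle cub.
have {}s0 : 0 < s by rewrite lt_neqAle eq_sym s0; case/andP: s01.
nra.
Qed.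

(** An explicit form of edges, free of dimension; [edge_between_adjacent] transfers
    triangle-freeness to it. *)
Definition edge_between u w :=
  [/\ u != w, vertex P u, vertex P w & face P (line_segment u w)].

Lemma edge_between_sym u w : edge_between u w -> edge_between w u.
Proof. by case=> uw Pu Pw Pe; split; rewrite 1?eq_sym// line_segmentC. Qed.

Lemma has_dim_line_segment u w : u != w -> has_dim (line_segment u w) 1.
Proof.
move=> uw; exists u, <[w - u]>%VS; split.
- exact: line_segmentl.
- move=> _ [s _ ->]; rewrite /affine_subspace/=.
  have -> : (1 - s) *: u + s *: w - u = s *: (w - u).
    by apply/rowP => i; rewrite !mxE; ring.
  by rewrite rpredZ// memv_line.
- by move=> W sub; rewrite -memvE; apply: sub; exact: line_segmentr.
- by rewrite dim_vline subr_eq0 eq_sym uw.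
Qed.

Lemma edge_between_adjacent u w : edge_between u w -> Defs.adjacent P u w.
Proof.
case=> uw Pu Pw Pe; split=> //; exists (line_segment u w); split.
- by split=> //; exact: has_dim_line_segment.
- exact: line_segmentl.
- exact: line_segmentr.
Qed.

(** A common point would put an end of the first edge into the second, which is a face; being a
    vertex, that end would be an end of the second edge. *)
Lemma edges_disjoint u w u' w' : edge_between u w -> edge_between u' w' ->
    [/\ u != u', u != w', w != u' & w != w'] ->
  line_segment u w `&` line_segment u' w' = set0.
Proof.
case=> _ Pu Pw _ [_ Pu' Pw' Pe'] [/eqP uu' /eqP uw' /eqP wu' /eqP ww'].
apply/eqP/negP => /negP/set0P[x [xe xe']].
have [||/(vertex_in_segment Pu)|/(vertex_in_segment Pw)] := face_segment Pe' _ _ xe xe'.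
- exact: vertex_in.
- exact: vertex_in.
- by case=> //; exact: vertex_in.
- by case=> //; exact: vertex_in.
Qed.

Lemma IVT_segment (f : 'rV[R]_n -> R) u w (t : R) :
    {within P, continuous f} -> line_segment u w `<=` P -> f u <= t <= f w ->
  (f @` line_segment u w) t.
Proof.
move=> cf sub /andP[ut tw].
have segE : line_segment u w = (fun s : R => (1 - s) *: u + s *: w) @` `[0, 1].
  apply/seteqP; split=> [_ [s s01 ->]|_ [s s01 <-]];
    exists s => //; have := s01; rewrite set_itvE.
have : connected (f @` line_segment u w).
  apply: connected_continuous_connected; last exact: continuous_subspaceW cf.
  rewrite segE; apply: connected_continuous_connected.
    exact: segment_connected.
  apply: continuous_subspaceT => s; apply: cvgD; apply: cvgZr_tmp.
    by apply: cvgB; [exact: cvg_cst | exact: cvg_id].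
  exact: cvg_id.
move=> /connected_intervalP ivl; apply: (ivl (f u) (f w)); last exact/andP.
- by exists u => //; exact: line_segmentl.
- by exists w => //; exact: line_segmentr.
Qed.

End FacesOfSets.

(** * Vertices and edges of the convex hull of a finite set *)

Section Hull.
Variables (R : realType) (n : nat) (A : seq 'rV[R]_n).
Implicit Types (c u v w x a : 'rV[R]_n).
Let P := convex_hull [set` A].

Lemma hull_sub (S : set 'rV[R]_n) : @convex_set R 'rV[R]_n S ->
  {in A, forall a, S a} -> P `<=` S.
Proof. by move=> cS AS; apply: smallest_sub. Qed.

Lemma mem_hull a : a \in A -> P a.
Proof. by move=> aA S [_ +]; apply. Qed.

Lemma convex_hull_convex : @convex_set R 'rV[R]_n P.
Proof.
apply/convex_setP => u w Pu Pw x xuw S [cS AS].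
by move/convex_setP: (cS); apply; [exact: Pu | exact: Pw | exact: xuw].
Qed.

(** It suffices to test the inequality and its equality case on the generators, as
    [convex_halfspace] extends both to the hull. *)
Lemma exposed_face c (b : R) (S : set 'rV[R]_n) : @convex_set R 'rV[R]_n S ->
    S `<=` P `&` [set x | dot c x = b] ->
    {in A, forall a, dot c a <= b} -> {in A, forall a, dot c a = b -> S a} ->
  face P S.
Proof.
move=> cS SP Ab AS.
have sub : P `<=` [set x | dot c x <= b /\ (dot c x = b -> S x)].
  apply: hull_sub; first exact: convex_halfspace.
  by move=> a aA; split; [exact: Ab | exact: AS].
apply/faceP; exists c, b; split=> [x /sub[]//|].
by apply/seteqP; split=> // x [/sub[_]].
Qed.

Lemma exposed_vertex c v : v \in A ->
  {in A, forall a, a != v -> dot c a < dot c v} -> vertex P v.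
Proof.
move=> vA cv; apply: (@exposed_face c (dot c v)).
- exact: convex_point.
- by move=> _ ->; split=> //; exact: mem_hull.
- by move=> a aA; have [->//|/(cv a aA)/ltW] := eqVneq a v.
- move=> a aA; have [//|/(cv a aA)] := eqVneq a v.
  by move=> /[swap] ->; rewrite ltxx.
Qed.

Lemma vertex_mem v : vertex P v -> v \in A.
Proof.
move=> Pv; have [c cv] := vertex_face Pv; apply/negPn/negP => vA.
(* With [set0] as the tight part this is the open half-space; it would contain all generators but
   not [v]. *)
have [] : [set x | dot c x <= dot c v /\ (dot c x = dot c v -> set0 x)] v.
  apply: hull_sub (vertex_in Pv); first by apply: convex_halfspace; apply/convex_setP.
  move=> a aA; have /(cv a (mem_hull aA)) av : a != v by apply: contraNneq vA => <-.
  by split; [exact: ltW | move=> e; rewrite e ltxx in av].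
by move=> _; exact.
Qed.

(* A vertex of the vertex figure spanned by the points [(a - v) / l (a - v)],
   where [- l] exposes [v], is the direction of an edge at [v]. *)
Lemma improving_edge c v a : vertex P v -> a \in A -> dot c v < dot c a ->
  exists2 w, edge_between P v w & dot c v < dot c w.
Proof.
move=> Pv aA cva; have [l0 l0v] := vertex_face Pv.
pose l := - l0; have l_gt0 x : x \in A -> x != v -> 0 < dot l (x - v).
  by move=> xA xv; have := l0v x (mem_hull xA) xv; rewrite !dotE; lra.
clearbody l; pose q x := (dot l (x - v))^-1 *: (x - v).
have av : a != v by apply: contraTneq cva => ->; rewrite ltxx.
have [|_ [th [/mapP[m + ->] thq cq _]]] :=
  @exposed_max _ _ [seq q x | x <- A & x != v] c (q a).
  by apply: map_f; rewrite mem_filter av.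
rewrite mem_filter => /andP[mv mA].
have qA x : x \in A -> x != v -> q x \in [seq q x | x <- A & x != v].
  by move=> xA xv; apply: map_f; rewrite mem_filter xv.
have qE x : x \in A -> x != v -> x - v = dot l (x - v) *: q x.
  by move=> xA xv; rewrite scalerA divff ?scale1r// gt_eqF// l_gt0.
(* Several generators may lie on the ray from [v] in direction [q m]; the edge ends at the farthest
   one. *)
have [|w] := @seq_argmax R _ [seq x <- A | (x != v) && (q x == q m)]
  (fun x => dot l (x - v)) m.
  by rewrite mem_filter mv eqxx.
rewrite mem_filter => /andP[/andP[wv /eqP qw] wA] wmax.
have cqm : 0 < dot c (q m).
  apply: lt_le_trans (cq _ (qA a aA av)).
  rewrite dotZr mulr_gt0 ?invr_gt0 ?l_gt0// dotDr dotNr; lra.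
have cw : dot c v < dot c w.
  rewrite -subr_gt0 -dotNr -dotDr qE// qw dotZr mulr_gt0//.
  exact: l_gt0.
(* As [l] equals 1 on every [q x], this shift makes [th'] vanish on [q m] and negative on all other
   [q x], so it supports the hull along the ray. *)
pose th' := th - dot th (q m) *: l.
have th'A x : x \in A -> x != v -> dot th' (x - v) <= 0 ?= iff (q x == q m).
  move=> xA xv; rewrite [in X in dot _ X]qE//.
  have lx := l_gt0 _ xA xv.
  have lq : dot l (q x) = 1 by rewrite dotZr mulVf ?gt_eqF.
  have -> : dot th' (dot l (x - v) *: q x) =
      dot l (x - v) * (dot th (q x) - dot th (q m)).
    by rewrite dotZr; congr (_ * _); rewrite dotDl dotNl dotZl lq mulr1.
  have [->|qx] := eqVneq (q x) (q m).
    by rewrite subrr mulr0; split; rewrite ?lexx ?eqxx.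
  have := thq _ (qA x xA xv) qx; rewrite -subr_lt0 => thx.
  have lt0 : dot l (x - v) * (dot th (q x) - dot th (q m)) < 0 by rewrite pmulr_rlt0.
  by split; rewrite ?ltW// lt_eqF.
clearbody th'; have th'w : dot th' w = dot th' v.
  apply/eqP; rewrite -subr_eq0 -dotNr -dotDr (th'A w wA wv).2.
  by rewrite qw.
have th'le x : x \in A -> dot th' x <= dot th' v.
  move=> xA; have [->//|xv] := eqVneq x v.
  by rewrite -subr_le0 -dotNr -dotDr (th'A x xA xv).1.
have th'eq x : x \in A -> x != v -> dot th' x = dot th' v -> q x = q w.
  move=> xA xv e; rewrite qw; apply/eqP.
  by rewrite -(th'A x xA xv).2 dotDr dotNr e subrr.
have Pw : vertex P w.
  (* [th'] is maximal exactly at [v] and the generators on the ray; [l] breaks the tie in favour of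
     [w]. *)
  have [k [k0 hk]] := lex_functional A th' l.
  apply: (@exposed_vertex (k *: th' + l)) => // x xA xw.
  have := th'le x xA; rewrite -th'w le_eqVlt => /orP[/eqP e|]; last exact: hk.
  rewrite !dotE e ltrD2l.
  have [->|xv] := eqVneq x v.
    by have := l_gt0 w wA wv; rewrite !dotE; lra.
  have qxw : q x = q w by apply: th'eq; rewrite ?e.
  have := wmax x; rewrite mem_filter xv qxw qw eqxx xA => /(_ isT).
  rewrite le_eqVlt !dotE => /orP[|]; last lra.
  move=> /eqP e'; case/eqP: xw; apply: (addIr (- v)).
  by rewrite qE// [RHS]qE// qxw !dotE e'.
exists w => //; split; rewrite 1?eq_sym//.
apply: (@exposed_face th' (dot th' v)) => //; first exact: convex_line_segment.
  move=> x xvw; split.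
    have /convex_setP := convex_hull_convex; apply; last exact: xvw.
      exact: mem_hull (vertex_mem Pv).
    exact: mem_hull.
  by case: xvw => s _ -> /=; rewrite !dotE th'w; ring.
move=> x xA e; have [->|xv] := eqVneq x v; first exact: line_segmentl.
have lw := l_gt0 w wA wv; have lx := l_gt0 x xA xv.
have qx := th'eq x xA xv e.
have lxw : dot l (x - v) <= dot l (w - v).
  by apply: wmax; rewrite mem_filter xv qx qw eqxx xA.
exists (dot l (x - v) / dot l (w - v)).
  by apply/andP; split; [rewrite divr_ge0 ?ltW | rewrite ler_pdivrMr ?mul1r].
apply: (addIr (- v)); rewrite {1}qE// qx.
have -> : q w = (dot l (w - v))^-1 *: (w - v) by [].
by rewrite scalerA; apply/rowP => i; rewrite !mxE; ring.
Qed.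

End Hull.

(** * Balinski's theorem *)

Section Balinski.
Variables (R : realType) (n : nat) (A : seq 'rV[R]_n) (d : nat).
Let P := convex_hull [set` A].
Hypothesis dimP : has_dim P d.
Implicit Types (c v w x a : 'rV[R]_n) (C : seq 'rV[R]_n).

(** Fewer than [d] differences [x - v] span a space of dimension below [d], so some generator
    escapes its translate through [v] and a functional separates it. *)
Lemma functional_constant_on v C : P v -> (size C < d)%N ->
  exists c, {in C, forall x, dot c x = dot c v} /\
    exists2 a, a \in A & dot c a != dot c v.
Proof.
move=> Pv sC; pose W := span [seq x - v | x <- C].
have [a aA aW] : exists2 a, a \in A & a - v \notin W.
  apply/not_exists2P => AW; have [v0 [U [Pv0 _ minU dimU]]] := dimP.
  have PW : P `<=` affine_subspace v W.
    apply: hull_sub; first exact: convex_affine_subspace.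
    by move=> a aA; case: (AW a) => // /negP/negPn.
  (* Minimality of [U] is stated at the base point [v0], so the subspace is moved there from [v]. *)
  have /minU/dimvS : P `<=` affine_subspace v0 W.
    move=> x /PW xW; have v0W := PW _ Pv0.
    rewrite /affine_subspace/= -(subrKA v x) addrC.
    by rewrite rpredD// -opprB rpredN.
  rewrite dimU leqNgt => /negP; apply.
  by apply: leq_ltn_trans (dim_span _) _; rewrite size_map.
have [c [c0 ca]] := span_separation aW.
exists c; split=> [x xC|]; last by exists a; rewrite // -subr_eq0 -dotNr -dotDr.
by apply/eqP; rewrite -subr_eq0 -dotNr -dotDr c0//; exact: (map_f (fun y => y - v)).
Qed.

(** Climbing from level at least [b] gets strictly above [b], hence off [C], and keeps [S] constant
    up to the top [t]. Instead of following a path, the proof takes a counterexample of greatest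
    [l], where [l] refines [c] and has [t] as its only maximizer. *)
Lemma ascend c (b : R) C (S : pred 'rV[R]_n) a :
    a \in A -> b < dot c a -> {in C, forall x, dot c x <= b} ->
    (forall v w, edge_between P v w -> v \notin C -> w \notin C -> S v = S w) ->
  exists t, forall v, vertex P v -> v \notin C -> b <= dot c v -> S v = S t.
Proof.
move=> aA cab Cb SE.
have [t [l [tA tl tc lc]]] := exposed_max c aA.
exists t => v Pv vC cv; apply/eqP/negPn/negP => Svt.
pose bad x := [&& `[< vertex P x >], x \notin C, b <= dot c x & S x != S t].
have [|m] := @seq_argmax R _ [seq x <- A | bad x] (dot l) v.
  by rewrite mem_filter (vertex_mem Pv) andbT; apply/and4P; split=> //; exact/asboolP.
rewrite mem_filter => /andP[/and4P[/asboolP Pm mC cm Smt] mA] mmax.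
have higher w : edge_between P m w -> b < dot c w -> dot l m < dot l w -> False.
  move=> mw cw lmw; have [_ _ Pw _] := mw.
  have wC : w \notin C by apply: contraTN cw => /Cb; rewrite -leNgt.
  suff : dot l w <= dot l m by rewrite leNgt lmw.
  apply: mmax; rewrite mem_filter (vertex_mem Pw) andbT; apply/and4P; split => //.
  - exact/asboolP.
  - exact: ltW.
  - by rewrite -(SE _ _ mw).
have [cmb|cmb] := ltrP b (dot c m).
  (* Above level [b] an [l]-improving edge suffices: [c] cannot drop along it, since a drop in [c]
     would be one in [l]. *)
  have mt : m != t by apply: contraNneq Smt => ->.
  have [w mw lmw] := improving_edge Pm tA (tl m mA mt).
  apply: (higher w) => //; apply: lt_le_trans cmb _.
  have [_ _ Pw _] := mw; rewrite leNgt; apply/negP => /lc.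
  by rewrite (vertex_mem Pw) mA => /(_ isT isT)/(lt_trans lmw); rewrite ltxx.
(* On level [b] itself [l] might improve without leaving the level, so [c] is improved instead,
   towards [a]. *)
have [w mw cmw] := improving_edge Pm aA (le_lt_trans cmb cab).
have [_ _ Pw _] := mw; apply: (higher w) => //.
  exact: le_lt_trans cmw.
by apply: lc => //; exact: vertex_mem.
Qed.

(* Balinski: choose [c] constant on [C] and [v]; from every vertex outside [C]
   climb to the top of [c] or descend to its bottom, off the level of [C]. *)
Lemma balinski C (S : pred 'rV[R]_n) : (size C < d)%N ->
    (forall v w, edge_between P v w -> v \notin C -> w \notin C -> S v = S w) ->
  forall v w, vertex P v -> vertex P w -> v \notin C -> w \notin C -> S v = S w.
Proof.
move=> sC SE v w Pv Pw vC wC.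
have [c [cC [a aA cav]]] := functional_constant_on (vertex_in Pv) sC.
have up c' a' : a' \in A -> {in C, forall x, dot c' x = dot c' v} ->
    dot c' v < dot c' a' -> exists t, forall x, vertex P x -> x \notin C ->
      dot c' v <= dot c' x -> S x = S t.
  by move=> a'A c'C lt; apply: ascend a'A lt _ SE => x /c'C->.
wlog cva : c cC cav / dot c v < dot c a => [hwlog|].
  have [lt|lt] := ltrP (dot c v) (dot c a); first exact: (hwlog c).
  apply: (hwlog (- c)) => [x xC||]; rewrite !dotNl ?eqr_opp//; first by rewrite cC.
  by rewrite ltrN2 lt_neqAle cav.
have [t top] := up c a aA cC cva.
have [cw|cw] := lerP (dot c v) (dot c w); first by rewrite (top v) ?(top w).
(* Now [w] is strictly below the level of [v], so it witnesses that [- c] can rise; [v], lying on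
   the level, descends to the same bottom as [w]. *)
have [] := up (- c) w (vertex_mem Pw).
- by move=> x xC; rewrite !dotNl cC.
- by rewrite !dotNl ltrN2.
- move=> t' bot; rewrite (bot v) ?(bot w)// !dotNl lerN2; exact: ltW.
Qed.

Definition vertices := undup [seq v <- A | `[< vertex P v >]].

Lemma mem_vertices v : reflect (vertex P v) (v \in vertices).
Proof.
rewrite mem_undup mem_filter; apply: (iffP andP) => [[/asboolP]//|Pv].
by split; [exact/asboolP | exact: vertex_mem].
Qed.

(** With at most [d] vertices, some functional nonconstant on [A] would agree on all of them; yet
    its maximum and minimum over [A] are attained at vertices. *)
Lemma size_vertices : (0 < d)%N -> (d < size vertices)%N.
Proof.
move=> d0; rewrite ltnNge; apply/negP => sV.
have [v0 [_ [Pv0 _ _ _]]] := dimP.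
have [_ [_ [a0 a0A _]]] := functional_constant_on (C := [::]) Pv0 d0.
(* For the zero functional this exposes a generator of largest norm, which provides a first
   vertex. *)
have [v [l [vA vl _ _]]] := exposed_max 0 a0A.
have Pv : vertex P v by exact: exposed_vertex vl.
have sC : (size (rem v vertices) < d)%N.
  have vV : v \in vertices by exact/mem_vertices.
  by rewrite size_rem// (leq_trans _ sV)// prednK//; case: (vertices) vV.
have [c [cV [a aA cav]]] := functional_constant_on (vertex_in Pv) sC.
have cst w : vertex P w -> dot c w = dot c v.
  move=> Pw; have [->//|wv] := eqVneq w v; apply: cV.
  by rewrite mem_rem_uniq ?undup_uniq// inE wv; exact/mem_vertices.
have [t [l1 [tA tl tmax _]]] := exposed_max c aA.
have [t' [l' [t'A t'l t'max _]]] := exposed_max (- c) aA.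
have ct : dot c t = dot c v by apply: cst; exact: exposed_vertex tl.
have ct' : dot c t' = dot c v by apply: cst; exact: exposed_vertex t'l.
have := tmax a aA; have := t'max a aA; rewrite !dotNl lerN2 ct ct' => le1 le2.
by case/eqP: cav; apply/eqP; rewrite eq_le le1 le2.
Qed.

Definition vertex_adj : rel (seq_sub vertices) :=
  fun v w : seq_sub vertices => `[< edge_between P (val v) (val w) >].

Lemma vertex_adj_irr : irreflexive vertex_adj.
Proof. by move=> v; apply/asboolPn => -[]; rewrite eqxx. Qed.

Lemma vertex_valP (v : seq_sub vertices) : vertex P (val v).
Proof. exact/mem_vertices/valP. Qed.

(** If no edge left [S] outside [C], membership in [S] would be constant along edges avoiding [C],
    so [balinski] would make it constant on all vertices outside [C]. *)
Lemma vertex_adj_connected r : (r <= d)%N -> vertex_connected vertex_adj r.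
Proof.
move=> rd S C sC SC /finset.set0Pn[v vS] /finset.set0Pn[w].
rewrite finset.inE => wSC; apply: contrapT => noedge.
pose im (B : {set seq_sub vertices}) := [seq val s | s <- enum B].
have mem_im B s : (val s \in im B) = (s \in B).
  by rewrite mem_map ?mem_enum//; exact: val_inj.
have SE x y : edge_between P x y -> x \notin im C -> y \notin im C ->
    x \in im S -> y \in im S.
  move=> exy xC + /mapP[s + xs]; rewrite mem_enum => yC sS.
  have [_ _ /mem_vertices yV _] := exy; pose y' := SeqSub yV.
  move: yC; rewrite -[y]/(val y') !mem_im => yC; apply: contrapT => /negP yS.
  apply: noedge; exists s, y'; split=> //; first by rewrite finset.inE negb_or yS.
  by apply/asboolP; rewrite -xs.
have : (val v \in im S) = (val w \in im S).
  apply: (@balinski (im C) (mem (im S))) => [|x y exy xC yC|||| ].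
  - by rewrite size_map -cardE (leq_trans sC).
  - by apply/idP/idP; apply: SE => //; exact: edge_between_sym.
  - exact: vertex_valP.
  - exact: vertex_valP.
  - rewrite mem_im; apply/negP => vC.
    have : v \in S :&: C by rewrite finset.inE vS.
    by rewrite SC finset.inE.
  - by rewrite mem_im; apply: contra wSC => wC; rewrite finset.inE wC orbT.
rewrite !mem_im vS => wS; case/negP: wSC.
by rewrite finset.inE -wS.
Qed.

End Balinski.

(** * Disjoint edges through a common level *)

Theorem polytope_disjoint_faces_meet (R : realType) (n r d : nat)
    (P : set 'rV[R]_n) : (0 < r <= d)%N -> polytope P -> has_dim P d ->
  triangle_free P -> disjoint_faces_meet r P.
Proof.
move=> /andP[r0 rd] [_ /finite_seqP[A ->] {P}->] dimP trif f cf.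
set P := convex_hull _ in dimP trif cf *.
have rT : (0 < r < #|{: seq_sub (vertices A)}|)%N.
  rewrite r0 card_seq_sub ?undup_uniq//.
  by apply: leq_ltn_trans (size_vertices dimP _); rewrite ?(leq_trans r0).
have noT (x y z : seq_sub (vertices A)) :
    vertex_adj x y -> vertex_adj y z -> vertex_adj x z -> False.
  move=> /asboolP xy /asboolP yz /asboolP xz; apply: trif.
  by exists (val x), (val y), (val z); split; exact: edge_between_adjacent.
have [a [b [t [eab ab disj]]]] := level_matching (@vertex_adj_irr R n A)
  (vertex_adj_connected dimP rd) (fun v : seq_sub (vertices A) => f (val v)) rT noT.
have eP i : edge_between P (val (a i)) (val (b i)).
  by have /asboolP := eab i.
exists (fun i => line_segment (val (a i)) (val (b i))); split=> [i||].
- by have [] := eP i.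
- apply/trivIsetP => i j _ _ ij; apply: edges_disjoint (eP i) (eP j) _.
  by have [] := disj i j ij; rewrite -!val_eqE.
- exists t => i; apply: IVT_segment cf _ (ab i).
  have [_ Pa Pb _] := eP i.
  by move/convex_setP: (@convex_hull_convex R n A); apply; exact: vertex_in.
Qed.

(** * The hypercube *)

Section Hypercube.
Variables (R : realType) (n : nat).
Implicit Types (u v w x : 'rV[R]_n).

Definition row_with x i (a : R) : 'rV[R]_n := \row_j if j == i then a else x 0 j.

Lemma hypercube_row_with x i (a : R) : hypercube R n x -> 0 <= a <= 1 ->
  hypercube R n (row_with x i a).
Proof. by move=> xn a01 j; rewrite mxE; case: eqP. Qed.

Lemma convex_hypercube : @convex_set R 'rV[R]_n (hypercube R n).
Proof.
apply/convex_setP => u w un wn _ [s s01 ->] i; rewrite !mxE.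
have := un i; have := wn i; nra.
Qed.

(** Induction on the number of coordinates other than 0 and 1: setting one of them to 0 and to 1
    gives the ends of a segment through [x], with that coordinate as parameter. *)
Lemma hypercube_sub_convex (S : set 'rV[R]_n) : @convex_set R 'rV[R]_n S ->
  (forall b : {ffun 'I_n -> bool}, S (\row_i (b i)%:R)) -> hypercube R n `<=` S.
Proof.
move=> /convex_setP cS bS x.
have [k] := ubnP #|[pred i | (x 0 i != 0) && (x 0 i != 1)]|.
elim: k x => // k IH x; rewrite ltnS => xk xn.
have [[i xi]|x01] := pselect (exists i, (x 0 i != 0) && (x 0 i != 1)); last first.
  rewrite (_ : x = \row_i ([ffun i => x 0 i == 1] i)%:R) //.
  apply/rowP => i; rewrite mxE ffunE; case: eqVneq => //= x1.
  by apply/eqP/negPn/negP => x0; apply: x01; exists i; rewrite x0.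
have rS a : (a == 0) || (a == 1) -> S (row_with x i a).
  move=> a01; have a01F : (a != 0) && (a != 1) = false by rewrite -negb_or a01.
  apply: IH; last first.
    by apply: hypercube_row_with => //; case/orP: a01 => /eqP->; rewrite ?lexx ler01.
  apply: leq_trans xk; apply: proper_card; apply/properP; split.
    apply/fintype.subsetP => j; rewrite !inE mxE.
    by case: (eqVneq j i) => // _; rewrite a01F.
  by exists i; rewrite !inE// mxE eqxx a01F.
apply: (cS _ _ (rS 0 _) (rS 1 _)); rewrite ?eqxx ?orbT//.
exists (x 0 i); first exact: xn.
by apply/rowP => j; rewrite !mxE; case: eqVneq => [->|_]; ring.
Qed.

Definition hypercube_vertices : seq 'rV[R]_n :=
  [seq \row_i (b i)%:R | b : {ffun 'I_n -> bool}].

Lemma hypercube_hull : hypercube R n = convex_hull [set` hypercube_vertices].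
Proof.
apply/seteqP; split.
  apply: hypercube_sub_convex; first exact: convex_hull_convex.
  by move=> b; apply: mem_hull; apply/mapP; exists b; rewrite ?mem_enum.
apply: hull_sub; first exact: convex_hypercube.
by move=> _ /mapP[b _ ->] i; rewrite mxE ler0n lern1 leq_b1.
Qed.

Lemma polytope_hypercube : polytope (hypercube R n).
Proof.
by exists [set` hypercube_vertices]; [exact: finite_seq | exact: hypercube_hull].
Qed.

Lemma has_dim_hypercube : has_dim (hypercube R n) n.
Proof.
exists 0, fullv; split.
- by move=> i; rewrite mxE lexx ler01.
- by move=> x _; rewrite /affine_subspace/= memvf.
- move=> W sub; apply/subvP => x _; rewrite [x]row_sum_delta.
  apply: rpred_sum => i _; apply: rpredZ.
  have : hypercube R n (delta_mx 0 i).
    by move=> j; rewrite mxE ler0n lern1 leq_b1.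
  by move/sub; rewrite /affine_subspace/= subr0.
- by rewrite dimvf dim_matrix; exact: mul1n.
Qed.

Lemma hypercube_vertex v i : vertex (hypercube R n) v -> v 0 i = 0 \/ v 0 i = 1.
Proof.
rewrite hypercube_hull => /vertex_mem/mapP[b _ ->].
by rewrite mxE; case: (b i); [right | left].
Qed.

(* Exchanging one of two differing coordinates of [u] and [w] preserves [u + w],
   so a face containing [u] and [w] also contains the two exchanged points. *)
Lemma hypercube_adjacent u w : Defs.adjacent (hypercube R n) u w ->
  exists i, u 0 i != w 0 i /\ forall j, j != i -> u 0 j = w 0 j.
Proof.
case=> uw Pu Pw [E [[/faceP[c [b [Pb EE]]] [v0 [U [_ EU _ dimU]]]] Eu Ew]].
have [i ui] : exists i, u 0 i != w 0 i.
  by move: uw; rewrite -subr_eq0 => /rV0Pn[i]; rewrite !mxE subr_eq0; exists i.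
exists i; split=> // j ji; apply: contrapT => /eqP uj.
pose u' := row_with u i (w 0 i); pose w' := row_with w i (u 0 i).
have Pu' : hypercube R n u' by apply: hypercube_row_with (vertex_in Pu) (vertex_in Pw i).
have Pw' : hypercube R n w' by apply: hypercube_row_with (vertex_in Pw) (vertex_in Pu i).
have Eu' : E u'.
  rewrite EE; split=> //=; move: Eu Ew; rewrite EE => -[_ /= ub] [_ /= wb].
  have : dot c u' + dot c w' = dot c u + dot c w.
    rewrite -!dotDr; congr dot; apply/rowP => k; rewrite !mxE.
    by case: eqVneq => [->|_]; ring.
  have := Pb _ Pu'; have := Pb _ Pw'; lra.
(* The edge has the single direction [w - u], so [u' - u] is [k] times it; coordinate [j] forces
   [k = 0], against coordinate [i]. *)
have UE : U = <[w - u]>%VS.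
  apply/esym/eqP; rewrite eqEdim dim_vline subr_eq0 eq_sym uw dimU leqnn andbT.
  by rewrite -memvE -(subrKA v0) rpredD ?rpredN ?EU// -opprB rpredN; exact: EU.
have : u' - u \in U.
  by rewrite -(subrKA v0) rpredD ?rpredN ?EU// -opprB rpredN; exact: EU.
rewrite UE => /vlineP[k /rowP uk].
have := uk j; have := uk i; rewrite !mxE eqxx (negbTE ji) subrr.
move=> ki /esym/eqP; rewrite mulf_eq0 subr_eq0 [_ == u 0 j]eq_sym (negbTE uj) orbF.
move=> /eqP k0; case/eqP: ui; move: ki; rewrite k0 mul0r => /eqP.
by rewrite subr_eq0 => /eqP.
Qed.

(** Each side changes a single coordinate. If two sides change the same one, three values in {0, 1}
    would be pairwise distinct there; if not, the third side would change two coordinates. *)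
Lemma triangle_free_hypercube : triangle_free (hypercube R n).
Proof.
case=> u [w [z [uw wz uz]]].
have [i [uwi uwj]] := hypercube_adjacent uw.
have [j [wzj wzi]] := hypercube_adjacent wz.
have [k [uzk uzl]] := hypercube_adjacent uz.
have neq : i != j.
  apply/negP => /eqP ij; rewrite -{j}ij in wzj wzi.
  have ki : k = i.
    by apply/eqP/negPn/negP => ki; case/eqP: uzk; rewrite uwj// wzi.
  rewrite {k}ki in uzk uzl; have [[_ Pu Pw _] [_ _ Pz _]] := (uw, wz).
  move: uwi wzj uzk.
  by case: (hypercube_vertex i Pu) => ->; case: (hypercube_vertex i Pw) => ->;
    case: (hypercube_vertex i Pz) => ->; rewrite eqxx.
have ki : i = k.
  by apply/eqP/negPn/negP => ik; case/eqP: uwi; rewrite (wzi i neq) uzl.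
rewrite -{k}ki in uzk uzl; rewrite eq_sym in neq.
by case/eqP: wzj; rewrite -uwj// uzl.
Qed.

End Hypercube.

Theorem theorem5p1 (R : realType) (r : nat) (r_gt0 : (0 < r)%N) :
  (forall (n : nat) (P : set 'rV[R]_n) (d : nat),
     polytope P -> has_dim P d -> (r <= d)%N -> triangle_free P ->
     disjoint_faces_meet r P)
  /\ disjoint_faces_meet r (hypercube R r).
Proof.
split=> [n P d polP dimP rd|].
  by apply: polytope_disjoint_faces_meet polP dimP; rewrite r_gt0.
apply: polytope_disjoint_faces_meet (has_dim_hypercube R r) _.
- by rewrite r_gt0 leqnn.
- exact: polytope_hypercube.
- exact: triangle_free_hypercube.
Qed.
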